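(* Let $0<\epsilon\ll 1$, let $B=(B_1,B_2,B_3)^{\intercal}\in\mathbb{R}^3$ be a constant vector with $|B|\ge 1$, let $\tilde B$ be the skew-symmetric matrix with $v\times B=\tilde B v$ for all $v\in\mathbb{R}^3$, and let $F(x)=-\nabla_x U(x)$ for a scalar potential $U$ on $\mathbb{R}^3$. The one-step method (EEP integrator) with stepsize $h$, $(x_n,v_n)\mapsto(x_{n+1},v_{n+1})$, defined by $$x_{n+1}=x_{n}+h\varphi_1\big(\tfrac{h}{\epsilon}\tilde B\big)v_{n}+h^2\varphi_2\big(\tfrac{h}{\epsilon}\tilde B\big)\int_0^1F\big(x_n+\sigma(x_{n+1}-x_n)\big)\,d\sigma,$$ $$v_{n+1}=e^{\frac{h}{\epsilon}\tilde B}v_n+h\varphi_1\big(\tfrac{h}{\epsilon}\tilde B\big)\int_0^1F\big(x_n+\sigma(x_{n+1}-x_n)\big)\,d\sigma,$$ is symmetric.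
   Context: The functions $\varphi_k$ are $\varphi_0(z)=e^z$ and $\varphi_k(z)=\int_0^1 e^{(1-\sigma)z}\frac{\sigma^{k-1}}{(k-1)!}\,d\sigma$ for $k=1,2$; they are entire functions, evaluated at matrices. Explicitly, $$\tilde B=\begin{pmatrix}0&B_3&-B_2\\ -B_3&0&B_1\\ B_2&-B_1&0\end{pmatrix}.$$ The method is designed for the system $\dot x=v$, $\dot v=\frac1\epsilon\tilde Bv+F(x)$. A one-step method is symmetric if exchanging $(x_n,v_n)\leftrightarrow(x_{n+1},v_{n+1})$ and $h\leftrightarrow -h$ in its defining equations leaves the method unchanged (gives an equivalent system of equations). *)

(* Defs.v *)
From HB Require Import structures.
From mathcomp Require Import all_boot all_order all_algebra.
From mathcomp Require Import ring.
From mathcomp Require Import all_classical all_reals all_analysis.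

Set Implicit Arguments.
Unset Strict Implicit.
Unset Printing Implicit Defensive.

Import Order.TTheory GRing.Theory Num.Theory.
Import numFieldNormedType.Exports.

Local Open Scope classical_set_scope.
Local Open Scope ring_scope.

(* The library norm [`|B|] on matrices is the sup norm, hence this one. *)
Definition enorm (R : realType) (n : nat) (v : 'cV[R]_n) : R :=
  Num.sqrt (\sum_(i < n) v i 0 ^+ 2).

Definition col3 (R : realType) (a b c : R) : 'cV[R]_3 :=
  \col_i nth 0 [:: a; b; c] i.

Definition mx3 (R : realType) (rows : seq (seq R)) : 'M[R]_3 :=
  \matrix_(i, j) nth 0 (nth [::] rows i) j.

Definition crossv (R : realType) (u v : 'cV[R]_3) : 'cV[R]_3 :=
  let u1 := u 0 0 in let u2 := u 1 0 in let u3 := u 2%:R 0 in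
  let v1 := v 0 0 in let v2 := v 1 0 in let v3 := v 2%:R 0 in
  col3 (u2 * v3 - u3 * v2) (u3 * v1 - u1 * v3) (u1 * v2 - u2 * v1).

Definition tildemx (R : realType) (B : 'cV[R]_3) : 'M[R]_3 :=
  let B1 := B 0 0 in let B2 := B 1 0 in let B3 := B 2%:R 0 in
  mx3 [:: [:: 0; B3; - B2];
          [:: - B3; 0; B1];
          [:: B2; - B1; 0]].

Lemma crossvE (R : realType) (v B : 'cV[R]_3) : crossv v B = tildemx B *m v.
Proof.
apply/matrixP => i j; rewrite !mxE !big_ord_recl big_ord0 !mxE ord1.
have -> : lift ord0 ord0 = 1 :> 'I_3 by apply/val_inj.
have -> : lift ord0 (lift ord0 ord0) = 2%:R :> 'I_3 by apply/val_inj.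
by case: i => [[|[|[|//]]] ?] /=; ring.
Qed.

Definition grad (R : realType) (n : nat) (U : 'cV[R]_n.+1 -> R)
    (x : 'cV[R]_n.+1) : 'cV[R]_n.+1 :=
  \col_i 'D_(delta_mx i 0) U x.

Definition intmx01 (R : realType) (m n : nat) (G : R -> 'M[R]_(m, n)) :
    'M[R]_(m, n) :=
  \matrix_(i, j) \int[lebesgue_measure]_(s in `[0, 1]) G s i j.

Definition expmx (R : realType) (n : nat) (A : 'M[R]_n.+1) : 'M[R]_n.+1 :=
  limn (series (fun k => k`!%:R^-1 *: A ^+ k)).

(* phi_k(A), the integral formula for the entire function phi_k read with a
   matrix argument. *)
Definition phimx (R : realType) (n : nat) (k : nat) (A : 'M[R]_n.+1) :
    'M[R]_n.+1 :=
  if k is j.+1 then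
    intmx01 (fun s => (s ^+ j / j`!%:R) *: expmx ((1 - s) *: A))
  else expmx A.

(* A possibly implicit one-step method on the states T = (x, v): [M h y0 y1]
   means that y0 = y_n and y1 = y_{n+1} satisfy the defining equations with
   stepsize h. *)
Definition one_step_method (R T : Type) := R -> T -> T -> Prop.

Definition symmetric_method (R : realType) (T : Type)
    (M : one_step_method R T) : Prop :=
  forall (h : R) (y0 y1 : T), M h y0 y1 <-> M (- h) y1 y0.

Definition EEP (R : realType) (eps : R) (B : 'cV[R]_3)
    (F : 'cV[R]_3 -> 'cV[R]_3) : one_step_method R ('cV[R]_3 * 'cV[R]_3) :=
  fun h y0 y1 =>
    let: (x0, v0) := y0 in
    let: (x1, v1) := y1 in
    let A := (h / eps) *: tildemx B in
    let I := intmx01 (fun s => F (x0 + s *: (x1 - x0))) in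
    x1 = x0 + h *: (phimx 1 A *m v0) + h ^+ 2 *: (phimx 2 A *m I) /\
    v1 = expmx A *m v0 + h *: (phimx 1 A *m I).

(* Main.v *)
Require Import Defs.
From HB Require Import structures.
From mathcomp Require Import all_boot all_order all_algebra.
From mathcomp Require Import all_classical all_reals all_analysis.

(** The method maps (x0, v0) to (x1, v1) by
      x1 = x0 + h phi_1(A) v0 + h^2 phi_2(A) I,
      v1 = e^A v0 + h phi_1(A) I,
    where A = (h/eps) B~ and I is the mean of F over the segment from x0 to x1.
    Exchanging the two states and the sign of h turns A into -A and leaves I
    unchanged, because s |-> 1 - s preserves Lebesgue measure on [0, 1]
    (Rintegral01_reflect). Solving the second equation for v0 and substituting
    in the first one then gives the reversed equations, provided that
      e^(-A) e^A = 1,    phi_1(-A) = e^(-A) phi_1(A) = phi_1(A) e^(-A),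
      phi_2(A) + phi_2(-A) = phi_1(A) phi_1(-A).
    For scalars z <> 0 these follow from phi_1(z) = (e^z - 1) / z and
    phi_2(z) = (e^z - 1 - z) / z^2; but B~ is skew of odd order, hence singular,
    and one cannot divide by A.

    The identities are therefore proved for every square matrix A by
    differentiating in t the functions t^k phi_k(t A), which are the power
    series
      e_k(t) = sum_(m >= k) t^m / m! A^(m - k).
    These satisfy e_(k+1)' = e_k with e_(k+1)(0) = 0, and
    e_0 = 1 + A e_1 = 1 + e_1 A, so that e_0' = A e_0 and e_0 commutes with A.
    Both sides of each identity, with e_k(t) in place of phi_k(A), take the same
    value at t = 0 and have the same derivative, so they agree at t = 1
    (is_derive_mx_inj; phi_series0_mulN, phi_series1N_mull, phi_series1N_mulr,
    phi_series2_addN). For phi_k defined by its integral, phi_k(A) = e_k(1)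
    follows by repeated integration by parts (intmx01_phi_series, phimxE). *)

Set Implicit Arguments.
Unset Strict Implicit.
Unset Printing Implicit Defensive.

Import Order.TTheory GRing.Theory Num.Theory.
Import numFieldNormedType.Exports.

Local Open Scope classical_set_scope.
Local Open Scope ring_scope.

(** * Integrals under a measure-preserving involution *)

Section MeasurePreservingInvolution.
Context d (T : measurableType d) (R : realType).
Context (mu : {measure set T -> \bar R}) (phi : T -> T)
  (mphi : measurable_fun setT phi) (phiK : involutive phi)
  (mu_phi : forall A, measurable A -> mu (phi @^-1` A) = mu A).
Import HBNNSimple.

(** The integral of a nonnegative function is the supremum of the integrals of
    the simple functions below it, and [h |-> h \o phi] sends the simple
    functions below [f] to simple functions below [f \o phi] with the same
    integral. Applying this again to [f \o phi] gives equality, as [phi] is an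
    involution. *)
Let ge0_integral_le (f : T -> \bar R) : (forall x, (0 <= f x)%E) ->
  (\int[mu]_x f x <= \int[mu]_x f (phi x))%E.
Proof.
move=> f0; rewrite [leLHS]ge0_integralTE// [leRHS]ge0_integralTE//.
apply: ge_ereal_sup => _ [/= h hf <-].
have mh : measurable_fun setT (h \o phi).
  by apply: measurableT_comp => //; exact: measurable_funPT.
have fh : finite_set (range (h \o phi)).
  apply: (@sub_finite_set _ _ (range h)); last exact: fimfunP.
  by move=> _ [x _ <-]; exists (phi x).
have h0 x : 0 <= (h \o phi) x by exact: fun_ge0.
pose g : {nnsfun T >-> R} := HB.pack (h \o phi)
  (isMeasurableFun.Build _ _ _ _ _ mh) (FiniteImage.Build _ _ _ fh)
  (isNonNegFun.Build _ _ _ h0).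
apply: ereal_sup_ubound; exists g; first by move=> x; exact: hf.
rewrite /sintegral; apply: eq_fsbigr => r _; congr (_ * _)%E.
by rewrite -(@mu_phi (h @^-1` [set r])).
Qed.

Let ge0_integral_involution (f : T -> \bar R) : (forall x, (0 <= f x)%E) ->
  (\int[mu]_x f (phi x) = \int[mu]_x f x)%E.
Proof.
move=> f0; apply/eqP; rewrite eq_le ge0_integral_le// andbT.
under [leRHS]eq_integral do rewrite -[X in f X]phiK.
exact: (@ge0_integral_le (f \o phi) (fun x => f0 (phi x))).
Qed.

Let integralT_involution (f : T -> \bar R) :
  (\int[mu]_x f (phi x) = \int[mu]_x f x)%E.
Proof.
rewrite [LHS]integralE [RHS]integralE -(@ge0_integral_involution (f ^\+)%E)//.
rewrite -(@ge0_integral_involution (f ^\-)%E)//.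
by congr (_ - _)%E; apply: eq_integral => x _; rewrite ?funeposE ?funenegE.
Qed.

(** [f] is arbitrary because it will be a component of a gradient, whose
    measurability would otherwise have to be established first. *)
Lemma integral_involution (D : set T) (f : T -> \bar R) :
  (\int[mu]_(x in phi @^-1` D) f (phi x) = \int[mu]_(x in D) f x)%E.
Proof.
rewrite [LHS]integral_mkcond [RHS]integral_mkcond.
have -> : (fun x => f (phi x)) \_ (phi @^-1` D) = (f \_ D) \o phi.
  by apply/funext => x; rewrite /patch /=; congr (if _ then _ else _).
exact: integralT_involution.
Qed.

End MeasurePreservingInvolution.

Section Reflection.
Context {R : realType}.
Local Notation mu := (@lebesgue_measure R).

Lemma lebesgue_measure_reflect (c : R) (A : set R) : measurable A ->
  mu ((fun x => c - x) @^-1` A) = mu A.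
Proof.
move=> mA; have mo : measurable_fun setT (fun x : R => c - x).
  exact: measurable_realfun.measurable_funB.
rewrite -[LHS]/(pushforward mu ((fun x => c - x) : _ -> measurableTypeR R) A).
apply/esym/lebesgue_measure_unique => //= _ [[a b]] _ <-.
rewrite /pushforward.
(* The preimage is closed on the other side, but has the same length. *)
have -> : ((fun x => c - x) @^-1` `]a, b]%classic) = `[c - b, c - a[%classic.
  apply/seteqP; split=> x /=; rewrite !in_itv/= => /andP[h1 h2].
    by rewrite lerBlDl -lerBlDr h2/= ltrBrDl -ltrBrDr h1.
  by rewrite ltrBrDl -ltrBrDr h2/= lerBlDl -lerBlDr h1.
rewrite !lebesgue_measure_itv/= !lte_fin ltrD2l ltrN2.
by rewrite -!EFinB [in RHS]opprB [in RHS]addrC [in RHS]addrA subrK.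
Qed.

Lemma Rintegral01_reflect (f : R -> R) :
  \int[mu]_(s in `[0, 1]) f (1 - s) = \int[mu]_(s in `[0, 1]) f s.
Proof.
rewrite /Rintegral; congr fine.
rewrite -[RHS](@integral_involution _ _ _ mu (fun s : R => 1 - s)).
- congr (integral _ _ _); apply/seteqP; split=> s /=; rewrite !in_itv/=.
    by move=> /andP[s0 s1]; rewrite subr_ge0 s1 gerBl.
  by rewrite subr_ge0 gerBl => /andP[-> ->].
- exact: measurable_realfun.measurable_funB.
- exact: subKr.
- exact: lebesgue_measure_reflect.
Qed.
End Reflection.

(** * Entrywise calculus of matrix-valued functions *)

Section MatrixCalculus.
Context {R : realType}.

Lemma cvg_mxP (m n : nat) (u : nat -> 'M[R]_(m, n)) (U : 'M[R]_(m, n)) :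
  u @ \oo --> U <-> forall i j, u k i j @[k --> \oo] --> U i j.
Proof.
split=> [uU i j|uU].
  apply: (@cvg_comp _ _ _ u (fun M : 'M[R]_(m, n) => M i j) _ _ _ uU).
  exact: coord_continuous.
move=> P [Q /= UQ QP]; suff : \forall k \near \oo, P (u k) by [].
near=> k; apply: QP => i j.
suff : forall ij, Q ij.1 ij.2 (u k ij.1 ij.2) by move=> /(_ (i, j)).
near: k; apply: filter_forall => -[i' j']; exact: (uU i' j' _ (UQ i' j')).
Unshelve. all: by end_near. Qed.

Lemma cvg_mulmx (m n p q : nat) (P : 'M[R]_(p, m)) (Q : 'M[R]_(n, q))
    (u : nat -> 'M[R]_(m, n)) (U : 'M[R]_(m, n)) :
  u @ \oo --> U -> P *m u k *m Q @[k --> \oo] --> P *m U *m Q.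
Proof.
move=> /cvg_mxP uU; apply/cvg_mxP => i j; rewrite mxE.
under eq_fun do rewrite mxE.
apply: cvg_big => [|l _]; first exact: add_continuous.
apply: cvgM; last exact: cvg_cst.
rewrite mxE; under eq_fun do rewrite mxE.
apply: cvg_big => [|l' _]; first exact: add_continuous.
by apply: cvgM; [exact: cvg_cst|exact: uU].
Qed.

Lemma is_derive_mxP (m n : nat) (F : R -> 'M[R]_(m, n)) (t : R) dF :
  is_derive t 1 F dF <->
  forall i j, is_derive t 1 (fun s => F s i j) (dF i j).
Proof.
split=> [[dF1 <-] i j|dF1].
  have /derivable_mxP dF2 := dF1; rewrite derive_mx// mxE; exact: derivableP.
have dF2 : derivable F t 1 by apply/derivable_mxP => i j; have [] := dF1 i j.
apply: DeriveDef => //; rewrite derive_mx//; apply/matrixP => i j.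
by rewrite mxE; have [] := dF1 i j.
Qed.

Lemma is_derive_mulmx (m n p : nat) (F : R -> 'M[R]_(m, n))
    (G : R -> 'M[R]_(n, p)) (t : R) dF dG :
  is_derive t 1 F dF -> is_derive t 1 G dG ->
  is_derive t 1 (fun s => F s *m G s) (dF *m G t + F t *m dG).
Proof.
move=> /is_derive_mxP dF1 /is_derive_mxP dG1; apply/is_derive_mxP => i j.
have -> : (fun s => (F s *m G s) i j) =
   \sum_(l < n) (fun s => F s i l * G s l j).
  by apply/funext => s; rewrite mxE fct_sumE.
have dFG l : is_derive t 1 (fun s => F s i l * G s l j)
    (F t i l * dG l j + G t l j * dF i l).
  exact: (@is_deriveM _ _ (fun s => F s i l) (fun s => G s l j)).
apply: is_derive_eq.
rewrite !mxE -big_split/=; apply: eq_bigr => l _.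
rewrite addrC; congr (_ + _); exact: mulrC.
Qed.

(** Applied to the two sides of an identity between phi functions, this
    reduces it to an identity between phi functions of lower index. *)
Lemma is_derive_mx_inj (m n : nat) (F G dF : R -> 'M[R]_(m, n)) :
  (forall t : R, is_derive t 1 F (dF t)) ->
  (forall t : R, is_derive t 1 G (dF t)) ->
  F 0 = G 0 -> F =1 G.
Proof.
move=> dF1 dG1 FG0 t; apply/matrixP => i j; apply/eqP; rewrite -subr_eq0.
have <- : ((fun s => F s i j) - (fun s => G s i j)) 0 = 0.
  by rewrite !fctE FG0 subrr.
apply/eqP/(@is_derive_0_is_cst R (_ - _)) => x.
have /is_derive_mxP/(_ i j) dFij := dF1 x.
have /is_derive_mxP/(_ i j) dGij := dG1 x.
by apply: is_derive_eq; rewrite subrr.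
Qed.

Lemma is_derive_scalemx (m n : nat) (a : R -> R) (F : R -> 'M[R]_(m, n))
    (t : R) da dF :
  is_derive t 1 a da -> is_derive t 1 F dF ->
  is_derive t 1 (fun s => a s *: F s) (da *: F t + a t *: dF).
Proof.
move=> da1 /is_derive_mxP dF1; apply/is_derive_mxP => i j.
have dF1ij := dF1 i j.
have -> : (fun s => (a s *: F s) i j) = a * (fun s => F s i j).
  by apply/funext => s; rewrite mxE.
apply: is_derive_eq.
by rewrite !mxE addrC; congr (_ + _); exact: mulrC.
Qed.

Lemma is_derive_mx_reflect (m n : nat) (F : R -> 'M[R]_(m, n)) (c t : R) dF :
  is_derive (c - t) 1 F dF -> is_derive t 1 (fun s => F (c - s)) (- dF).
Proof.
move=> /is_derive_mxP dF1; apply/is_derive_mxP => i j.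
have dFij := dF1 i j.
have dc : is_derive t 1 (fun s : R => c - s) (- 1).
  rewrite (_ : (fun s => c - s) = cst c - id)//.
  by apply: is_derive_eq; rewrite sub0r.
have := @is_derive1_comp _ (fun s => F s i j) (fun s => c - s) _ _ _ dFij dc.
by rewrite mulrN1 mxE.
Qed.

Lemma is_derive_mx_continuous (m n : nat) (F dF : R -> 'M[R]_(m, n)) :
  (forall t : R, is_derive t 1 F (dF t)) -> continuous F.
Proof.
move=> dF1 t; apply/differentiable_continuous/derivable1_diffP.
by have [] := dF1 t.
Qed.

Lemma intmx01_FTC (m n : nat) (F f : R -> 'M[R]_(m, n)) :
  (forall s : R, is_derive s 1 F (f s)) ->
  continuous f -> intmx01 f = F 1 - F 0.
Proof.
move=> dF cf; apply/matrixP => i j; rewrite !mxE.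
have dFij (s : R) : is_derive s 1 (fun s => F s i j) (f s i j).
  by have /is_derive_mxP/(_ i j) := dF s.
have cF : continuous (fun s => F s i j).
  move=> s; apply/differentiable_continuous/derivable1_diffP.
  by have [] := dFij s.
rewrite /Rintegral (@continuous_FTC2 _ _ (fun s => F s i j))//.
- apply: continuous_subspaceT => s.
  apply: (@continuous_comp _ _ _ f (fun M : 'M[R]_(m, n) => M i j)).
    exact: cf.
  exact: coord_continuous.
- split => [s _||]; first by have [] := dFij s.
    exact/cvg_at_right_filter/cF.
  exact/cvg_at_left_filter/cF.
- by move=> s _; rewrite derive1E; have [] := dFij s.
Qed.

End MatrixCalculus.

(** * The phi functions as power series *)

Section PhiSeries.
Context {R : realType} {n : nat}.
Implicit Types (A : 'M[R]_n.+1) (k m : nat) (t : R).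

Definition phi_term A k t m : 'M[R]_n.+1 :=
  ((k <= m)%:R * t ^+ m / m`!%:R) *: A ^+ (m - k).

(** This is t^k phi_k(t A): the power t^k is absorbed so that differentiation
    in t lowers the index by one, with no factor 1 / t. *)
Definition phi_series A k t : 'M[R]_n.+1 := limn (series (phi_term A k t)).

Lemma expmxE A t : expmx (t *: A) = phi_series A 0 t.
Proof.
rewrite /expmx.
have -> // : (fun m => m`!%:R^-1 *: (t *: A) ^+ m) = phi_term A 0 t.
by apply/funext => m; rewrite /phi_term subn0 mul1r mulrC -scalerA exprZn.
Qed.

(** The coefficients of one entry of [phi_series], an ordinary real power
    series; the truncated [m - k] is masked by the first factor. *)
Definition phi_coef A k (i j : 'I_n.+1) m : R :=
  (k <= m)%:R * (A ^+ (m - k)) i j / m`!%:R.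

Lemma phi_coef_diffs A k i j :
  pseries_diffs (phi_coef A k.+1 i j) = phi_coef A k i j.
Proof.
apply/funext => m; rewrite /pseries_diffs /phi_coef ltnS subSS factS natrM.
by rewrite invfM mulrCA mulVKf.
Qed.

Lemma expr_mx_entry_bound A : exists2 M : R, 1 <= M &
  forall m i j, `|(A ^+ m) i j| <= M ^+ m.
Proof.
pose S := \sum_i \sum_j `|A i j|.
have S0 : 0 <= S by do 2 apply: sumr_ge0 => ? _.
(* 1 is added so that powers of the bound also grow with the exponent. *)
exists (1 + S) => [|m]; first by rewrite lerDl.
have M0 : 0 <= 1 + S by rewrite addr_ge0.
elim: m => [|m IH] i j.
  by rewrite !expr0 mxE; case: eqP; rewrite ?normr1 ?normr0.
rewrite exprS -mulmxE mxE (le_trans (ler_norm_sum _ _ _))//.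
apply: (@le_trans _ _ (\sum_l `|A i l| * (1 + S) ^+ m)).
  by apply: ler_sum => l _; rewrite normrM ler_wpM2l.
rewrite -mulr_suml exprS ler_wpM2r ?exprn_ge0//.
apply: (@le_trans _ _ S); last by rewrite lerDr.
by rewrite /S [leRHS](bigD1 i)//= lerDl; do 2 apply: sumr_ge0 => ? _.
Qed.

Lemma is_cvg_pseries_exp_bound (a : R^nat) (C M t : R) : 0 <= M ->
  (forall m, `|a m| <= C * M ^+ m / m`!%:R) -> cvgn (pseries a t).
Proof.
move=> M0 aM; apply: normed_cvg.
have C0 : 0 <= C by have := aM 0%N; rewrite fact0 divr1 mulr1; exact: le_trans.
have cE := is_cvg_seriesZ (k := C) (is_cvg_series_exp_coeff (M * `|t|)).
apply: (series_le_cvg _ _ _ cE) => m /=.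
- exact: normr_ge0.
- by rewrite mulr_ge0// /exp_coeff /= divr_ge0// exprn_ge0// mulr_ge0.
rewrite normrM normrX -[leRHS]/(C * ((M * `|t|) ^+ m / m`!%:R)).
rewrite exprMn mulrA mulrA mulrAC.
by rewrite ler_wpM2r ?exprn_ge0.
Qed.

Lemma is_cvg_phi_coef A k i j t : cvgn (pseries (phi_coef A k i j) t).
Proof.
have [M M1 AM] := expr_mx_entry_bound A.
apply: (@is_cvg_pseries_exp_bound _ 1 M); first exact: le_trans M1.
move=> m; rewrite mul1r /phi_coef 2!normrM normfV !normr_nat.
rewrite ler_wpM2r ?invr_ge0//.
case: leqP => km; last by rewrite mul0r exprn_ge0// (le_trans _ M1).
by rewrite mul1r (le_trans (AM _ _ _))// ler_weXn2l// leq_subr.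
Qed.

(** For [k = 0] the differentiated series has coefficients A^(m+1) / m!, which
    would be the index -1 of the family, and the bound acquires a factor M. *)
Lemma is_cvg_phi_coef_diffs A k i j t :
  cvgn (pseries (pseries_diffs (phi_coef A k i j)) t).
Proof.
case: k => [|k]; last by rewrite phi_coef_diffs; exact: is_cvg_phi_coef.
have [M M1 AM] := expr_mx_entry_bound A.
apply: (@is_cvg_pseries_exp_bound _ M M); [exact: le_trans M1..|].
move=> m; rewrite /pseries_diffs /phi_coef subn0 mul1r factS natrM.
rewrite invfM mulrCA mulVKf// normrM normfV normr_nat -exprS.
by rewrite ler_wpM2r ?invr_ge0.
Qed.

Lemma series_phi_termE A k i j t :
  (fun N => series (phi_term A k t) N i j) = pseries (phi_coef A k i j) t.
Proof.
apply/funext => N; rewrite /pseries /series /= summxE; apply: eq_bigr => m _.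
rewrite /phi_term /phi_coef mxE mulrAC [in RHS]mulrAC.
by congr (_ / _); exact: mulrAC.
Qed.

Lemma cvg_phi_series A k t :
  series (phi_term A k t) @ \oo --> phi_series A k t.
Proof.
suff : cvgn (series (phi_term A k t)) by [].
apply: (@cvgP _ _ (\matrix_(i, j) limn (pseries (phi_coef A k i j) t))).
apply/cvg_mxP => i j; rewrite mxE series_phi_termE; exact: is_cvg_phi_coef.
Qed.

Lemma phi_series_entryE A k t i j :
  phi_series A k t i j = limn (pseries (phi_coef A k i j) t).
Proof.
apply/esym/cvg_lim => //; rewrite -series_phi_termE.
exact: (cvg_mxP _ _).1 (@cvg_phi_series A k t) i j.
Qed.

Lemma is_derive_phi_series A k t :
  is_derive t 1 (phi_series A k.+1) (phi_series A k t).
Proof.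
apply/is_derive_mxP => i j.
have -> : (fun s => phi_series A k.+1 s i j) =
    (fun s => limn (pseries (phi_coef A k.+1 i j) s)).
  by apply/funext => s; rewrite phi_series_entryE.
rewrite phi_series_entryE -(phi_coef_diffs A k).
apply: (@pseries_snd_diffs _ _ (`|t| + 1)).
- exact: is_cvg_phi_coef.
- exact: is_cvg_phi_coef_diffs.
- by rewrite phi_coef_diffs; exact: is_cvg_phi_coef_diffs.
- by rewrite (@ger0_norm _ (`|t| + 1)) ?addr_ge0// ltrDl.
Qed.

Lemma phi_seriesS0 A k : phi_series A k.+1 0 = 0.
Proof.
apply/cvg_lim => //; apply: cvg_near_cst; near=> N.
rewrite /series /= big1// => m _; rewrite /phi_term.
by case: m => [|m]; rewrite ?mul0r ?scale0r// exprS mul0r mulr0 mul0r scale0r.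
Unshelve. all: by end_near. Qed.

(** Taking one factor A out of every term but the constant one; [P] and [Q]
    are A and 1 in either order, so that the factor can leave on both sides. *)
Let phi_series_rec A t (P Q : 'M[R]_n.+1) :
  (forall m, P *m A ^+ m *m Q = A ^+ m.+1) ->
  phi_series A 0 t = 1%:M + P *m phi_series A 1 t *m Q.
Proof.
move=> PAQ; apply/cvg_lim => //; rewrite -cvg_shiftS.
have -> : (fun N => series (phi_term A 0 t) N.+1) =
    (fun N => 1%:M + P *m series (phi_term A 1 t) N.+1 *m Q).
  apply/funext => N; rewrite /series /= !big_nat_recl//.
  rewrite {1 3}/phi_term mul0r mul0r scale0r add0r.
  rewrite expr0 fact0 divr1 mul1r scale1r.
  congr (_ + _); rewrite mulmx_sumr mulmx_suml; apply: eq_bigr => m _.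
  by rewrite /phi_term -scalemxAr -scalemxAl subn0 subSS subn0 PAQ.
apply: cvgD; first exact: cvg_cst.
rewrite (cvg_shiftS (fun N => P *m series (phi_term A 1 t) N *m Q)).
exact/cvg_mulmx/cvg_phi_series.
Qed.

Lemma phi_series0_mull A t : phi_series A 0 t = 1%:M + A *m phi_series A 1 t.
Proof.
rewrite (@phi_series_rec A t A 1%:M) ?mulmx1// => m.
by rewrite mulmx1 exprS.
Qed.

Lemma phi_series0_mulr A t : phi_series A 0 t = 1%:M + phi_series A 1 t *m A.
Proof.
rewrite (@phi_series_rec A t 1%:M A) ?mul1mx// => m.
by rewrite mul1mx exprSr.
Qed.

Lemma phi_series00 A : phi_series A 0 0 = 1%:M.
Proof. by rewrite phi_series0_mull phi_seriesS0 mulmx0 addr0. Qed.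

Lemma phi_series0_comm A t : A *m phi_series A 0 t = phi_series A 0 t *m A.
Proof.
rewrite {1}phi_series0_mulr phi_series0_mull mulmxDr mulmxDl.
by rewrite mulmx1 mul1mx mulmxA.
Qed.

Lemma is_derive_phi_series0 A t :
  is_derive t 1 (phi_series A 0) (A *m phi_series A 0 t).
Proof.
rewrite [X in is_derive _ _ X _](_ : _ =
    cst 1%:M + (fun s => cst A s *m phi_series A 1 s)); last first.
  by apply/funext => s; rewrite phi_series0_mull.
have d1 := is_derive_phi_series A 0 t.
have dA : is_derive t 1 (cst A) 0 by exact: is_derive_cst.
have := is_derive_mulmx dA d1; rewrite mul0mx add0r => dM.
by apply: is_derive_eq; rewrite add0r.
Qed.

Lemma phi_series_continuous A k : continuous (phi_series A k).
Proof.
case: k => [|k]; apply: is_derive_mx_continuous => t.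
  exact: is_derive_phi_series0.
exact: is_derive_phi_series.
Qed.

(** The derivative of e_0(-A) e_0(A) is -A e_0(-A) e_0(A) + e_0(-A) A e_0(A),
    which vanishes because A commutes with e_0(-A). *)
Lemma phi_series0_mulN A t :
  phi_series (- A) 0 t *m phi_series A 0 t = 1%:M.
Proof.
apply: (@is_derive_mx_inj _ _ _
  (fun s => phi_series (- A) 0 s *m phi_series A 0 s)
  (cst 1%:M) (cst 0)) => [s|].
- have dM := is_derive_mulmx (is_derive_phi_series0 (- A) s)
    (is_derive_phi_series0 A s).
  apply: is_derive_eq.
  by rewrite phi_series0_comm mulmxN mulNmx mulmxA addNr.
- by rewrite !phi_series00 mul1mx.
Qed.

(** The derivative of the right-hand side is
    -e_0(-A) A e_1(A) + e_0(-A) e_0(A), and A e_1(A) = e_0(A) - 1 makes it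
    e_0(-A), the derivative of the left-hand side. *)
Lemma phi_series1N_mull A t :
  phi_series (- A) 1 t = phi_series (- A) 0 t *m phi_series A 1 t.
Proof.
apply: (@is_derive_mx_inj _ _ _ (phi_series (- A) 1)
  (fun s => phi_series (- A) 0 s *m phi_series A 1 s)
  (phi_series (- A) 0)) => [s|s|].
- exact: is_derive_phi_series.
- have dM := is_derive_mulmx (is_derive_phi_series0 (- A) s)
    (is_derive_phi_series A 0 s).
  apply: is_derive_eq.
  rewrite phi_series0_comm mulmxN mulNmx -mulmxA (phi_series0_mull A).
  by rewrite mulmxDr mulmx1 addrCA addNr addr0.
- by rewrite !phi_seriesS0 mulmx0.
Qed.

Lemma phi_series1N_mulr A t :
  phi_series (- A) 1 t = phi_series A 1 t *m phi_series (- A) 0 t.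
Proof.
apply: (@is_derive_mx_inj _ _ _ (phi_series (- A) 1)
  (fun s => phi_series A 1 s *m phi_series (- A) 0 s)
  (phi_series (- A) 0)) => [s|s|].
- exact: is_derive_phi_series.
- have dM := is_derive_mulmx (is_derive_phi_series A 0 s)
    (is_derive_phi_series0 (- A) s).
  apply: is_derive_eq.
  by rewrite mulNmx mulmxN mulmxA (phi_series0_mulr A) mulmxDl mul1mx addrK.
- by rewrite !phi_seriesS0 mul0mx.
Qed.

(** The right-hand side has derivative e_0(A) e_1(-A) + e_1(A) e_0(-A), which
    is e_1(A) + e_1(-A) by the two previous identities. *)
Lemma phi_series2_addN A t :
  phi_series A 2 t + phi_series (- A) 2 t =
  phi_series A 1 t *m phi_series (- A) 1 t.
Proof.
apply: (@is_derive_mx_inj _ _ _ (phi_series A 2 + phi_series (- A) 2)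
  (fun s => phi_series A 1 s *m phi_series (- A) 1 s)
  (phi_series A 1 + phi_series (- A) 1)) => [s|s|].
- have d2 := is_derive_phi_series A 1 s.
  have dN2 := is_derive_phi_series (- A) 1 s.
  exact: is_deriveD.
- have dM := is_derive_mulmx (is_derive_phi_series A 0 s)
    (is_derive_phi_series (- A) 0 s).
  apply: is_derive_eq.
  by rewrite -phi_series1N_mulr -{1}[A]opprK -phi_series1N_mull opprK.
- by rewrite !fctE !phi_seriesS0 mul0mx addr0.
Qed.

(** Integrating by parts moves one power of [s] to the index of the phi
    function: an antiderivative for [j.+1, k] is
    - s^(j+1) / (j+1)! e_(k+1)(1 - s) plus one for [j, k.+1], and the added
    term vanishes at both ends. The induction constructs explicit
    antiderivatives, so the integral is evaluated only once. *)
Lemma intmx01_phi_series A j k :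
  intmx01 (fun s => (s ^+ j / j`!%:R) *: phi_series A k (1 - s)) =
  phi_series A (k + j).+1 1.
Proof.
suff [F dF <-] : exists2 F : R -> 'M[R]_n.+1,
    forall s : R,
      is_derive s 1 F ((s ^+ j / j`!%:R) *: phi_series A k (1 - s)) &
    F 1 - F 0 = phi_series A (k + j).+1 1.
  apply: intmx01_FTC => // s.
  apply: cvgZ.
    by apply: cvgM; [exact: exprn_continuous|exact: cvg_cst].
  apply: (@cvg_comp _ _ _ (fun s => 1 - s) _ _ (nbhs (1 - s))).
    by apply: cvgB; [exact: cvg_cst|exact: cvg_id].
  exact: phi_series_continuous.
have dS i (s : R) : is_derive s 1 (fun u : R => phi_series A i.+1 (1 - u))
    (- phi_series A i (1 - s)).
  exact/is_derive_mx_reflect/is_derive_phi_series.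
elim: j k => [|j IH] k.
  exists (- (fun u => phi_series A k.+1 (1 - u))) => [s|].
    rewrite expr0 fact0 divr1 scale1r -[X in is_derive _ _ _ X]opprK.
    exact: is_deriveN.
  by rewrite !fctE subrr subr0 phi_seriesS0 oppr0 opprK add0r addn0.
have [F dF F01] := IH k.+1.
exists (F - (fun u => (u ^+ j.+1 / j.+1`!%:R) *: phi_series A k.+1 (1 - u)))
  => [s|].
  have da : is_derive s (1 : R) (fun u : R => u ^+ j.+1 / j.+1`!%:R)
      (s ^+ j / j`!%:R).
    have -> : (fun u : R => u ^+ j.+1 / j.+1`!%:R) =
        j.+1`!%:R^-1 *: (id ^+ j.+1).
      by apply/funext => u; rewrite [RHS]mulrC; congr (_ * _); rewrite fctE.
    apply: is_derive_eq.
    rewrite /GRing.scale /= mulr1 factS natrM invfM mulrC mulrA.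
    by rewrite [_ * s ^+ j]mulrC mulfK.
  have dM := is_derive_scalemx da (dS k s).
  apply: is_derive_eq.
  by rewrite opprD addrA subrr add0r scalerN opprK.
rewrite !fctE subrr subr0 phi_seriesS0 scaler0 exprS !mul0r scale0r !subr0.
by rewrite F01 addSnnS.
Qed.

Lemma phimxE A k : phimx k A = phi_series A k 1.
Proof.
case: k => [|j]; first by rewrite /= -[A in LHS]scale1r expmxE.
rewrite /phimx -[in RHS](add0n j) -intmx01_phi_series.
by congr intmx01; apply/funext => s; rewrite expmxE.
Qed.

End PhiSeries.

(** * Reversing one step *)

Lemma intmx01_segment_sym (R : realType) (m n p q : nat)
    (F : 'M[R]_(m, n) -> 'M[R]_(p, q)) (x y : 'M[R]_(m, n)) :
  intmx01 (fun s => F (y + s *: (x - y))) =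
  intmx01 (fun s => F (x + s *: (y - x))).
Proof.
apply/matrixP => i j; rewrite !mxE -[RHS]Rintegral01_reflect.
congr Rintegral; apply/funext => s; congr (F _ i j).
by rewrite scalerBl scale1r addrA (addrC x (y - x)) subrK -scalerN opprB.
Qed.

(** The identities between phi functions of A and -A turn the step solved for
    the old state into the step of size [- h]; this one implication is the whole
    symmetry, since a second application restores the states and [h]. *)
Lemma EEP_reverse (R : realType) (eps : R) (B : 'cV[R]_3)
    (F : 'cV[R]_3 -> 'cV[R]_3) (h : R) y0 y1 :
  EEP eps B F h y0 y1 -> EEP eps B F (- h) y1 y0.
Proof.
move: y0 y1 => [x0 v0] [x1 v1]; rewrite /EEP intmx01_segment_sym.
rewrite mulNr (scaleNr (h / eps)); set A := (h / eps) *: tildemx B.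
set I := intmx01 _ => -[x1E v1E]; rewrite -[expmx A]/(phimx 0 A) in v1E.
rewrite -[expmx _]/(phimx 0 (- A)) !phimxE in x1E v1E *.
set E := phi_series A 0 1 in x1E v1E *; set E' := phi_series (- A) 0 1.
(* This is the velocity equation multiplied by e^(-A). *)
have v0E : v0 = E' *m v1 - h *: (phi_series (- A) 1 1 *m I).
  rewrite v1E mulmxDr mulmxA phi_series0_mulN mul1mx -scalemxAr mulmxA.
  by rewrite -phi_series1N_mull addrK.
split; last by rewrite scaleNr.
have P1v0 : phi_series A 1 1 *m v0 =
    phi_series (- A) 1 1 *m v1 -
    h *: ((phi_series A 2 1 + phi_series (- A) 2 1) *m I).
  rewrite v0E mulmxBr mulmxA -phi_series1N_mulr -scalemxAr mulmxA.
  by rewrite phi_series2_addN.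
rewrite sqrrN x1E P1v0 scalerBr scalerA -expr2 mulmxDl scalerDr scaleNr.
rewrite -!addrA (addrCA (_ *: _) (- _) (_ *: _)) (addrCA (- (_ + _))).
by rewrite addNr addr0 subrr addr0.
Qed.

Theorem proposition2p3 (R : realType) (eps : R) (B : 'cV[R]_3)
    (U : 'cV[R]_3 -> R) (F : 'cV[R]_3 -> 'cV[R]_3)
    (eps_gt0 : 0 < eps) (eps_lt1 : eps < 1)
    (normB_ge1 : 1 <= enorm B)
    (U_diff : forall x : 'cV[R]_3, differentiable U x)
    (F_grad : forall x : 'cV[R]_3, F x = - grad U x) :
  symmetric_method (EEP eps B F).
Proof.
move=> h y0 y1; split; first exact: EEP_reverse.
by move=> /EEP_reverse; rewrite opprK.
Qed.
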